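(* The system $\mathsf{DG}+\mathsf{ACA}_0^{\mathrm{st}}$ is inconsistent, where $\mathsf{ACA}_0$ is the statement $(\forall f\le_1 1)(\exists g\le_1 1)(\forall n^{0})\big[(\exists m^0)(f(n,m)=0)\leftrightarrow g(n)=0\big]$ (with $f(n,m)$ denoting $f$ applied to a code of the pair $(n,m)$), and $\mathsf{ACA}_0^{\mathrm{st}}$ is this statement with all quantifiers relativised to $\mathrm{st}$: $(\forall^{\mathrm{st}} f\le_1 1)(\exists^{\mathrm{st}} g\le_1 1)(\forall^{\mathrm{st}} n^{0})\big[(\exists^{\mathrm{st}} m^0)(f(n,m)=0)\leftrightarrow g(n)=0\big]$.
   Context: Finite types: $0$ is a type and if $\rho,\sigma$ are types so is $\rho\to\sigma$; type $1=0\to0$, $2=1\to0$. $\mathsf{E\text{-}HA}^{\omega}$ is Heyting arithmetic in all finite types (intuitionistic logic, Gödel's $T$ constants) with extensionality. Equality $=_0$ is primitive; for $\tau=\tau_1\to\dots\to\tau_k\to0$, $x=_\tau y$ abbreviates $(\forall z_1\dots z_k)(xz_1\dots z_k=_0yz_1\dots z_k)$, and $\le_\tau$ likewise. Extensionality $(\mathsf E_{\rho\to\tau})$: $(\forall\varphi)(\forall x,y)(x=_\rho y\to\varphi(x)=_\tau\varphi(y))$, for all types. Binary sequences: $f\le_1 1$. Strong majorizability (Howard–Bezem): $x\le^*_0 y$ iff $x\le_0 y$; $x\le^*_{\rho\to\sigma}y$ iff for all $u,v$ with $u\le^*_\rho v$: $xu\le^*_\sigma yv$ and $yu\le^*_\sigma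 yv$. Monotone: $x\le^*x$; $\tilde\forall,\tilde\exists$ range over monotone objects. The language of $\mathsf{DG}$ adds predicates $\mathrm{st}^\sigma$ (''is standard''); $\forall^{\mathrm{st}},\exists^{\mathrm{st}}$ are the relativised quantifiers, $\tilde\forall^{\mathrm{st}},\tilde\exists^{\mathrm{st}}$ combine both restrictions. Internal = not containing $\mathrm{st}$. $\mathsf{DG}$ is $\mathsf{E\text{-}HA}^\omega$ in the extended language plus: (a) $x=_\sigma y\to(\mathrm{st}(x)\to\mathrm{st}(y))$; (b) $\mathrm{st}(y)\to(x\le^*_\sigma y\to\mathrm{st}(x))$; (c) $\mathrm{st}(t)$ for closed terms $t$; (d) $\mathrm{st}(z)\to(\mathrm{st}(x)\to\mathrm{st}(zx))$; external induction $\Phi(0)\wedge(\forall^{\mathrm{st}}n)(\Phi(n)\to\Phi(n+1))\to(\forall^{\mathrm{st}}n)\Phi(n)$ for any $\Phi$; and for arbitrary $\Phi,\Psi$ and internal $\phi,\psi$: $\mathsf{mAC}^\omega$: $(\tilde\forall^{\mathrm{st}}x)(\tilde\exists^{\mathrm{st}}y)\Phi(x,y)\to(\tilde\exists^{\mathrm{st}}f)(\tilde\forall^{\mathrm{st}}x)(\exists y\le^*f(x))\Phi(x,y)$; $\mathsf R^\omega$: $(\forall x)(\exists^{\mathrm{st}}y)\Phi(x,y)\to(\tilde\exists^{\mathrm{st}}z)(\forall x)(\exists y\le^*z)\Phi(x,y)$; $\mathsf I^\omega$: $(\tilde\forall^{\mathrm{st}}z)(\exists x)(\forall y\le^*z)\phi(x,y)\to(\exists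 x)(\forall^{\mathrm{st}}y)\phi(x,y)$; $\mathsf{IP}^\omega_{\tilde\forall^{\mathrm{st}}}$: $[(\tilde\forall^{\mathrm{st}}x)\phi(x)\to(\tilde\exists^{\mathrm{st}}y)\Psi(y)]\to(\tilde\exists^{\mathrm{st}}z)[(\tilde\forall^{\mathrm{st}}x)\phi(x)\to(\tilde\exists y\le^*z)\Psi(y)]$; $\mathsf M^\omega$: $[(\tilde\forall^{\mathrm{st}}x)\phi(x)\to\psi]\to(\tilde\exists^{\mathrm{st}}y)[(\forall x\le^*y)\phi(x)\to\psi]$; $\mathsf{MAJ}^\omega$: $(\forall^{\mathrm{st}}x)(\exists^{\mathrm{st}}y)(x\le^*y)$. *)

(* Defs.v *)
From Stdlib Require Import List.
Import ListNotations.

Set Implicit Arguments.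
Unset Strict Implicit.
Unset Printing Implicit Defensive.

Inductive ty : Type :=
| N : ty
| Arr : ty -> ty -> ty.

Declare Scope dg_scope.
Delimit Scope dg_scope with dg.
Open Scope dg_scope.

Notation "r ~> t" := (Arr r t) (at level 55, right associativity) : dg_scope.

(* The types of the free variables in scope; variables are typed de Bruijn
   indices into this list, the innermost binder first. *)
Definition ctx := list ty.

Inductive var : ctx -> ty -> Type :=
| V0 : forall G s, var (s :: G) s
| VS : forall G s t, var G t -> var (s :: G) t.

Arguments V0 {G s}.
Arguments VS {G s t} _.

Inductive term (G : ctx) : ty -> Type :=
| Var : forall s, var G s -> term G s
| Zero : term G N
| Succ : term G (N ~> N)
| Pi : forall s t, term G (s ~> t ~> s)
| Sigma : forall r s t, term G ((r ~> s ~> t) ~> (r ~> s) ~> r ~> t)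
| Rec : forall s, term G (N ~> s ~> (s ~> N ~> s) ~> s)
| App : forall s t, term G (s ~> t) -> term G s -> term G t.

Arguments Zero {G}.
Arguments Succ {G}.
Arguments Pi {G} s t.
Arguments Sigma {G} r s t.
Arguments Rec {G} s.

Notation "f @ x" := (App f x) (at level 40, left associativity) : dg_scope.

Inductive form (G : ctx) : Type :=
| Bot : form G
| Eq0 : term G N -> term G N -> form G
| St : forall s, term G s -> form G
| And : form G -> form G -> form G
| Or : form G -> form G -> form G
| Imp : form G -> form G -> form G
| All : forall s, form (s :: G) -> form G
| Ex : forall s, form (s :: G) -> form G.

Arguments Bot {G}.
Arguments All {G} s _.
Arguments Ex {G} s _.

Notation "A ⊓ B" := (And A B) (at level 71, right associativity) : dg_scope.
Notation "A ⊔ B" := (Or A B) (at level 72, right associativity) : dg_scope.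
Notation "A ⊃ B" := (Imp A B) (at level 73, right associativity) : dg_scope.
Notation "A ≡ B" := (And (Imp A B) (Imp B A)) (at level 74) : dg_scope.

Fixpoint internal G (A : form G) : bool :=
  match A with
  | Bot | Eq0 _ _ => true
  | St _ => false
  | And A B | Or A B | Imp A B => andb (internal A) (internal B)
  | All _ A | Ex _ A => internal A
  end.

Definition ren (G D : ctx) := forall s, var G s -> var D s.

Definition wk G s : ren G (s :: G) := fun _ v => VS v.
Arguments wk {G s} _ _.

Definition no_var G : ren [] G :=
  fun s v => match v in var E _ return match E with [] => var G s | _ => unit end
             with V0 => tt | VS _ => tt end.

Definition up_ren G D s (r : ren G D) : ren (s :: G) (s :: D) :=
  fun t v =>
    match v in var E u
      return match E with
             | [] => unit
             | s' :: G' => ren G' D -> var (s' :: D) u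
             end
    with
    | V0 => fun _ => V0
    | VS w => fun r => VS (r _ w)
    end r.
Arguments up_ren {G D s} r _ _.

Fixpoint ren_term G D (r : ren G D) t (a : term G t) : term D t :=
  match a with
  | Var v => Var (r _ v)
  | Zero => Zero
  | Succ => Succ
  | Pi s t => Pi s t
  | Sigma r s t => Sigma r s t
  | Rec s => Rec s
  | App f x => App (ren_term r f) (ren_term r x)
  end.

Fixpoint ren_form G D (r : ren G D) (A : form G) : form D :=
  match A with
  | Bot => Bot
  | Eq0 a b => Eq0 (ren_term r a) (ren_term r b)
  | St a => St (ren_term r a)
  | And A B => And (ren_form r A) (ren_form r B)
  | Or A B => Or (ren_form r A) (ren_form r B)
  | Imp A B => Imp (ren_form r A) (ren_form r B)
  | All s A => All s (ren_form (up_ren r) A)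
  | Ex s A => Ex s (ren_form (up_ren r) A)
  end.

Definition sub (G D : ctx) := forall s, var G s -> term D s.

Definition scons G D s (a : term D s) (f : sub G D) : sub (s :: G) D :=
  fun t v =>
    match v in var E u
      return match E with
             | [] => unit
             | s' :: G' => term D s' -> sub G' D -> term D u
             end
    with
    | V0 => fun a _ => a
    | VS w => fun _ f => f _ w
    end a f.

Definition up_sub G D s (f : sub G D) : sub (s :: G) (s :: D) :=
  scons (Var V0) (fun t v => ren_term wk (f t v)).
Arguments up_sub {G D s} f _ _.

Fixpoint sub_term G D (f : sub G D) t (a : term G t) : term D t :=
  match a with
  | Var v => f _ v
  | Zero => Zero
  | Succ => Succ
  | Pi s t => Pi s t
  | Sigma r s t => Sigma r s t
  | Rec s => Rec s
  | App g x => App (sub_term f g) (sub_term f x)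
  end.

Fixpoint sub_form G D (f : sub G D) (A : form G) : form D :=
  match A with
  | Bot => Bot
  | Eq0 a b => Eq0 (sub_term f a) (sub_term f b)
  | St a => St (sub_term f a)
  | And A B => And (sub_form f A) (sub_form f B)
  | Or A B => Or (sub_form f A) (sub_form f B)
  | Imp A B => Imp (sub_form f A) (sub_form f B)
  | All s A => All s (sub_form (up_sub f) A)
  | Ex s A => Ex s (sub_form (up_sub f) A)
  end.

Definition inst G s (a : term G s) (A : form (s :: G)) : form G :=
  sub_form (scons a (fun _ v => Var v)) A.

Notation "^ a" := (ren_term wk a) (at level 5, right associativity) : dg_scope.

Definition v0 {G s} : term (s :: G) s := Var V0.
Definition v1 {G s t} : term (t :: s :: G) s := Var (VS V0).

(* Bracket abstraction: the term language has combinators but no binder. *)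
Definition lam_var G s t (v : var (s :: G) t) : term G (s ~> t) :=
  match v in var E u
    return match E with [] => unit | s' :: G' => term G' (s' ~> u) end
  with
  | @V0 _ s => Sigma s (s ~> s) s @ Pi s (s ~> s) @ Pi s s
  | VS w => Pi _ _ @ Var w
  end.

Fixpoint lam G s t (a : term (s :: G) t) : term G (s ~> t) :=
  match a in term _ t return term G (s ~> t) with
  | Var v => lam_var v
  | Zero => Pi _ _ @ Zero
  | Succ => Pi _ _ @ Succ
  | Pi t u => Pi _ _ @ Pi t u
  | Sigma r t u => Pi _ _ @ Sigma r t u
  | Rec t => Pi _ _ @ Rec t
  | App f x => Sigma _ _ _ @ lam f @ lam x
  end.

Definition one G : term G N := Succ @ Zero.
Arguments one {G}.

(* In [Rec _ @ n @ y @ z] the step [z] takes the previous value, then the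
   index. *)
Definition predt G : term G (N ~> N) :=
  lam (Rec N @ v0 @ Zero @ lam (lam v0)).
Arguments predt {G}.

Definition addt G (a b : term G N) : term G N :=
  Rec N @ b @ a @ lam (lam (Succ @ v1)).

Definition monust G (a b : term G N) : term G N :=
  Rec N @ b @ a @ lam (lam (predt @ v1)).

Definition triangulart G (a : term G N) : term G N :=
  Rec N @ a @ Zero @ lam (lam (addt v1 (Succ @ v0))).

(* Cantor's pairing (n + m)(n + m + 1)/2 + m. *)
Definition pairt G (n m : term G N) : term G N :=
  addt (triangulart (addt n m)) m.

Fixpoint eqf G t : term G t -> term G t -> form G :=
  match t with
  | N => fun x y => Eq0 x y
  | s ~> t => fun x y => All s (eqf (^x @ v0) (^y @ v0))
  end.

Fixpoint lef G t : term G t -> term G t -> form G :=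
  match t with
  | N => fun x y => Eq0 (monust x y) Zero
  | s ~> t => fun x y => All s (lef (^x @ v0) (^y @ v0))
  end.

(* Howard--Bezem strong majorizability; under the two binders [u] is [v1]
   and [v] is [v0]. *)
Fixpoint maj G t : term G t -> term G t -> form G :=
  match t with
  | N => fun x y => lef x y
  | s ~> t => fun x y =>
      All s (All s (maj v1 v0 ⊃
        (maj (^ ^x @ v1) (^ ^y @ v0) ⊓ maj (^ ^y @ v1) (^ ^y @ v0))))
  end.

Infix "≐" := eqf (at level 70, no associativity) : dg_scope.
Infix "≦" := lef (at level 70, no associativity) : dg_scope.
Infix "≤*" := maj (at level 70, no associativity) : dg_scope.

Definition all_st G s (A : form (s :: G)) : form G := All s (St v0 ⊃ A).
Definition ex_st G s (A : form (s :: G)) : form G := Ex s (St v0 ⊓ A).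
Definition ex_mon G s (A : form (s :: G)) : form G := Ex s (v0 ≤* v0 ⊓ A).
Definition all_mon_st G s (A : form (s :: G)) : form G :=
  All s (St v0 ⊃ v0 ≤* v0 ⊃ A).
Definition ex_mon_st G s (A : form (s :: G)) : form G :=
  Ex s (St v0 ⊓ v0 ≤* v0 ⊓ A).
Definition all_maj G s (a : term G s) (A : form (s :: G)) : form G :=
  All s (v0 ≤* ^a ⊃ A).
Definition ex_maj G s (a : term G s) (A : form (s :: G)) : form G :=
  Ex s (v0 ≤* ^a ⊓ A).

Arguments all_st {G} s A.
Arguments ex_st {G} s A.
Arguments ex_mon {G} s A.
Arguments all_mon_st {G} s A.
Arguments ex_mon_st {G} s A.

(* Weakening below one or two bound variables: the axioms quantify a new
   variable outside the variables of the schematic formula. *)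
Definition wk1 G s r (A : form (s :: G)) : form (s :: r :: G) :=
  ren_form (up_ren wk) A.
Definition wk2 G s t r (A : form (s :: t :: G)) : form (s :: t :: r :: G) :=
  ren_form (up_ren (up_ren wk)) A.
Arguments wk1 {G s r} A.
Arguments wk2 {G s t r} A.

Definition theory := forall G, form G -> Prop.

(* Free variables of an axiom are universally quantified by the logic.
   Induction over all numbers is restricted to internal formulas: for formulas
   with [St] it would make every number standard, contradicting
   [idealization]. *)
Inductive EHAomega : theory :=
| eq0_refl G (x : term G N) : EHAomega (x ≐ x)
| eq0_sym G (x y : term G N) : EHAomega (x ≐ y ⊃ y ≐ x)
| eq0_trans G (x y z : term G N) : EHAomega (x ≐ y ⊃ y ≐ z ⊃ x ≐ z)
| succ_neq0 G (x : term G N) : EHAomega (Succ @ x ≐ Zero ⊃ Bot)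
| succ_inj G (x y : term G N) : EHAomega (Succ @ x ≐ Succ @ y ⊃ x ≐ y)
| ax_Pi G s t (x : term G s) (y : term G t) : EHAomega (Pi s t @ x @ y ≐ x)
| ax_Sigma G r s t (x : term G (r ~> s ~> t)) (y : term G (r ~> s)) z :
    EHAomega (Sigma r s t @ x @ y @ z ≐ x @ z @ (y @ z))
| ax_Rec0 G s (y : term G s) z : EHAomega (Rec s @ Zero @ y @ z ≐ y)
| ax_RecS G s (x : term G N) (y : term G s) z :
    EHAomega (Rec s @ (Succ @ x) @ y @ z ≐ z @ (Rec s @ x @ y @ z) @ x)
| extensionality G r t (f : term G (r ~> t)) (x y : term G r) :
    EHAomega (x ≐ y ⊃ f @ x ≐ f @ y)
| internal_induction G (A : form (N :: G)) : internal A = true ->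
    EHAomega (inst Zero A ⊓ All N (A ⊃ inst (Succ @ v0) (wk1 A)) ⊃ All N A).

(* A schematic formula [A : form (t :: s :: G)] stands for Φ(x, y) with [x]
   of type [s] and [y], the innermost variable, of type [t]. *)
Inductive DG : theory :=
| DG_EHA G (A : form G) : EHAomega A -> DG A
| st_eq G s (x y : term G s) : DG (x ≐ y ⊃ St x ⊃ St y)
| st_maj G s (x y : term G s) : DG (St y ⊃ x ≤* y ⊃ St x)
| st_closed G s (a : term [] s) : DG (St (ren_term (@no_var G) a))
| st_app G s t (z : term G (s ~> t)) (x : term G s) :
    DG (St z ⊃ St x ⊃ St (z @ x))
| external_induction G (A : form (N :: G)) :
    DG (inst Zero A ⊓ all_st N (A ⊃ inst (Succ @ v0) (wk1 A)) ⊃ all_st N A)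
| mAC G s t (A : form (t :: s :: G)) :
    DG (all_mon_st s (ex_mon_st t A) ⊃
        ex_mon_st (s ~> t) (all_mon_st s (ex_maj (v1 @ v0) (wk2 A))))
| realization G s t (A : form (t :: s :: G)) :
    DG (All s (ex_st t A) ⊃ ex_mon_st t (All s (ex_maj v1 (wk2 A))))
| idealization G s t (A : form (t :: s :: G)) : internal A = true ->
    DG (all_mon_st t (Ex s (all_maj v1 (wk2 A))) ⊃ Ex s (all_st t A))
| indep_premise G s t (A : form (s :: G)) (B : form (t :: G)) :
    internal A = true ->
    DG ((all_mon_st s A ⊃ ex_mon_st t B) ⊃
        ex_mon_st t (all_mon_st s (wk1 A) ⊃
                     ex_mon t (v0 ≤* v1 ⊓ wk1 B)))
| markov G s (A : form (s :: G)) (B : form G) :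
    internal A = true -> internal B = true ->
    DG ((all_mon_st s A ⊃ B) ⊃
        ex_mon_st s (all_maj v0 (wk1 A) ⊃ ren_form wk B))
| majorizability G s : DG (all_st s (ex_st s (v1 ≤* v0)) : form G).

Definition extend (T : theory) (A : form []) : theory :=
  fun G B => T G B \/ B = ren_form (@no_var G) A.

Inductive prv (T : theory) : forall G, list (form G) -> form G -> Prop :=
| prv_ax G (H : list (form G)) A : T G A -> prv T H A
| prv_hyp G (H : list (form G)) A : In A H -> prv T H A
| prv_botE G (H : list (form G)) A : prv T H Bot -> prv T H A
| prv_andI G (H : list (form G)) A B :
    prv T H A -> prv T H B -> prv T H (A ⊓ B)
| prv_andE1 G (H : list (form G)) A B : prv T H (A ⊓ B) -> prv T H A
| prv_andE2 G (H : list (form G)) A B : prv T H (A ⊓ B) -> prv T H B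
| prv_orI1 G (H : list (form G)) A B : prv T H A -> prv T H (A ⊔ B)
| prv_orI2 G (H : list (form G)) A B : prv T H B -> prv T H (A ⊔ B)
| prv_orE G (H : list (form G)) A B C :
    prv T H (A ⊔ B) -> prv T (A :: H) C -> prv T (B :: H) C -> prv T H C
| prv_impI G (H : list (form G)) A B : prv T (A :: H) B -> prv T H (A ⊃ B)
| prv_impE G (H : list (form G)) A B :
    prv T H (A ⊃ B) -> prv T H A -> prv T H B
| prv_allI G (H : list (form G)) s (A : form (s :: G)) :
    prv T (map (ren_form wk) H) A -> prv T H (All s A)
| prv_allE G (H : list (form G)) s (A : form (s :: G)) a :
    prv T H (All s A) -> prv T H (inst a A)
| prv_exI G (H : list (form G)) s (A : form (s :: G)) a :
    prv T H (inst a A) -> prv T H (Ex s A)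
| prv_exE G (H : list (form G)) s (A : form (s :: G)) C :
    prv T H (Ex s A) -> prv T (A :: map (ren_form wk) H) (ren_form wk C) ->
    prv T H C.

Definition inconsistent (T : theory) : Prop := prv T (@nil (form [])) Bot.

Definition binary G (f : term G (N ~> N)) : form G := f ≦ lam one.

(* (∀st f ≤ 1)(∃st g ≤ 1)(∀st n)[(∃st m) f(n, m) = 0 <-> g(n) = 0]; the bounds
   f ≤ 1 and g ≤ 1 are internal formulas, not relativised to [St]. *)
Definition ACA0st : form [] :=
  all_st (N ~> N) (binary v0 ⊃
    ex_st (N ~> N) (binary v0 ⊓
      all_st N (ex_st N (Var (VS (VS (VS V0))) @ pairt v1 v0 ≐ Zero)
                ≡ v1 @ v0 ≐ Zero))).

(* Main.v *)
(** Every binary sequence is majorized by the constant sequence 1, hence is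
    standard.  In particular, for an arbitrary (possibly nonstandard) number x
    the sequence f with f(p) = 0 iff x <= p is standard.  Comprehension applied
    to f at n = 0 decides whether x <= (0, m) for some standard m, i.e. whether
    x is standard: so "St x or not St x" holds for every number x.  Then every x
    has a standard y with "St x implies x = y", and realization gives a single
    standard z with x <= z for all standard x; take x = z + 1. *)

Require Import Defs.
From Stdlib Require Import List.
Import ListNotations.

Set Implicit Arguments.
Unset Strict Implicit.
Unset Printing Implicit Defensive.

(** * Variables, renaming, substitution and weakening *)

(** The match returns a predicate that is trivial on the empty context and quantifies over [P] in
    its return type, so no axiom about equality of contexts is needed. *)
Lemma var_cons_case G s (P : forall t, var (s :: G) t -> Prop) :
  P s V0 -> (forall t (w : var G t), P t (VS w)) ->
  forall t (v : var (s :: G) t), P t v.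
Proof.
intros H0 HS t v; revert P H0 HS.
exact (match v in var E u
         return match E as E' return var E' u -> Prop with
                | [] => fun _ => True
                | s' :: G' => fun v =>
                    forall P : forall t, var (s' :: G') t -> Prop,
                    P s' V0 -> (forall t (w : var G' t), P t (VS w)) -> P u v
                end v with
       | V0 => fun P H0 HS => H0
       | VS w => fun P H0 HS => HS _ w
       end).
Qed.

Lemma sub_term_id G t (a : term G t) : sub_term (fun s v => Var v) a = a.
Proof. induction a; simpl; congruence. Qed.

Lemma ren_term_comp G D E (r : ren G D) (q : ren D E) t (a : term G t) :
  ren_term q (ren_term r a) = ren_term (fun s v => q s (r s v)) a.
Proof. induction a; simpl; congruence. Qed.

Lemma sub_ren_term G D E (r : ren G D) (f : sub D E) t (a : term G t) :
  sub_term f (ren_term r a) = sub_term (fun s v => f s (r s v)) a.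
Proof. induction a; simpl; congruence. Qed.

Lemma ren_sub_term G D E (f : sub G D) (r : ren D E) t (a : term G t) :
  ren_term r (sub_term f a) = sub_term (fun s v => ren_term r (f s v)) a.
Proof. induction a; simpl; congruence. Qed.

(** [up_ren r] sends [VS v] to [VS (r v)] by computation, so the two composite renamings are
    convertible and functional extensionality is avoided. *)
Lemma ren_up_wk G D s (r : ren G D) t (a : term G t) :
  ren_term (@up_ren G D s r) (^a) = ^(ren_term r a).
Proof. now rewrite !ren_term_comp. Qed.

Lemma sub_up_wk G D s (f : sub G D) t (a : term G t) :
  sub_term (@up_sub G D s f) (^a) = ^(sub_term f a).
Proof. now rewrite sub_ren_term, ren_sub_term. Qed.

Lemma sub_scons_wk G D s (f : sub G D) (b : term D s) t (a : term G t) :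
  sub_term (scons b f) (^a) = sub_term f a.
Proof. now rewrite sub_ren_term. Qed.

Lemma sub_form_eqf t : forall G D (f : sub G D) (x y : term G t),
  sub_form f (x ≐ y) = (sub_term f x ≐ sub_term f y).
Proof.
induction t as [|s _ t IH]; intros; simpl; [reflexivity|].
now rewrite IH; simpl; rewrite !sub_up_wk.
Qed.

Lemma ren_form_eqf t : forall G D (r : ren G D) (x y : term G t),
  ren_form r (x ≐ y) = (ren_term r x ≐ ren_term r y).
Proof.
induction t as [|s _ t IH]; intros; simpl; [reflexivity|].
now rewrite IH; simpl; rewrite !ren_up_wk.
Qed.

Lemma prv_weaken T G (H H' : list (form G)) A :
  prv T H A -> incl H H' -> prv T H' A.
Proof.
intros P; revert H'; induction P; intros H' I.
- now apply prv_ax.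
- now apply prv_hyp, I.
- now apply prv_botE, IHP.
- apply prv_andI; auto.
- now apply prv_andE1 with B, IHP.
- now apply prv_andE2 with A, IHP.
- now apply prv_orI1, IHP.
- now apply prv_orI2, IHP.
- apply prv_orE with A B; auto using incl_cons, in_eq, incl_tl.
- apply prv_impI; auto using incl_cons, in_eq, incl_tl.
- apply prv_impE with A; auto.
- now apply prv_allI, IHP, incl_map.
- now apply prv_allE, IHP.
- now apply prv_exI with a, IHP.
- apply prv_exE with s A; auto using incl_cons, in_eq, incl_tl, incl_map.
Qed.

(** Signum: it truncates values to 0 and 1, which keeps [thr] binary. *)
Definition sgt G (a : term G N) : term G N := Rec N @ a @ Zero @ lam (lam one).

(* [thr @ x @ p] is 0 iff x <= p. *)
Definition thr G : term G (N ~> N ~> N) := lam (lam (sgt (monust v1 v0))).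
Arguments thr {G}.

Ltac hyp :=
  apply prv_hyp; cbn [In map]; repeat first [left; reflexivity | right].

(** * Equality, combinators and primitive recursive arithmetic over [EHAomega] *)

Section Arithmetic.

Context (T : theory) (EHA : forall G (A : form G), EHAomega A -> T G A).

Notation "H ⊢ A" := (prv T H A) (at level 75).

Lemma eha G (H : list (form G)) A : EHAomega A -> H ⊢ A.
Proof. now intros; apply prv_ax, EHA. Qed.

Lemma eqf_refl t : forall G (H : list (form G)) (x : term G t), H ⊢ x ≐ x.
Proof.
induction t as [|s _ t IH]; intros.
- apply eha, eq0_refl.
- apply prv_allI, IH.
Qed.

Lemma eqf_app_fun G (H : list (form G)) s t (f g : term G (s ~> t)) x :
  H ⊢ f ≐ g -> H ⊢ f @ x ≐ g @ x.
Proof.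
intros E; apply (prv_allE x) in E; revert E.
unfold inst; rewrite sub_form_eqf; simpl.
now rewrite !sub_scons_wk, !sub_term_id.
Qed.

(** Stated as an object-level implication, here and for transitivity: [prv_allI] then renames the
    assumed equation, whereas a rule on derivations would need derivability to be closed under
    renaming. *)
Lemma eqf_sym_imp t : forall G (H : list (form G)) (x y : term G t),
  H ⊢ (x ≐ y ⊃ y ≐ x).
Proof.
induction t as [|s _ t IH]; intros.
- apply eha, eq0_sym.
- apply prv_impI, prv_allI; simpl.
  rewrite ren_form_eqf; simpl; rewrite !ren_up_wk.
  apply (prv_impE (IH _ _ _ _)), eqf_app_fun.
  hyp.
Qed.

Lemma eqf_trans_imp t : forall G (H : list (form G)) (x y z : term G t),
  H ⊢ (x ≐ y ⊃ y ≐ z ⊃ x ≐ z).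
Proof.
induction t as [|s _ t IH]; intros.
- apply eha, eq0_trans.
- apply prv_impI, prv_impI, prv_allI; simpl.
  rewrite !ren_form_eqf; simpl; rewrite !ren_up_wk.
  refine (prv_impE (prv_impE (IH _ _ _ (^y @ v0) _) _) _);
    apply eqf_app_fun; hyp.
Qed.

Lemma eqf_sym G (H : list (form G)) t (x y : term G t) :
  H ⊢ x ≐ y -> H ⊢ y ≐ x.
Proof. exact (prv_impE (eqf_sym_imp H x y)). Qed.

Lemma eqf_trans G (H : list (form G)) t (x y z : term G t) :
  H ⊢ x ≐ y -> H ⊢ y ≐ z -> H ⊢ x ≐ z.
Proof.
intros E; exact (prv_impE (prv_impE (eqf_trans_imp H x y z) E)).
Qed.

Lemma eqf_app G (H : list (form G)) s t (f g : term G (s ~> t)) x y :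
  H ⊢ f ≐ g -> H ⊢ x ≐ y -> H ⊢ f @ x ≐ g @ y.
Proof.
intros Ef Ex; apply eqf_trans with (f @ y).
- exact (prv_impE (eha _ (extensionality _ _ _)) Ex).
- now apply eqf_app_fun.
Qed.

(* The substitution [f] is part of the statement so that [beta2] follows without
   commuting [lam] with substitution. *)
Lemma beta_sub G s t (b : term (s :: G) t) D (H : list (form D))
    (f : sub G D) (x : term D s) :
  H ⊢ sub_term f (lam b) @ x ≐ sub_term (scons x f) b.
Proof.
induction b; cbn [lam sub_term]; try exact (eha _ (ax_Pi _ _)).
- revert s0 v; apply var_cons_case; intros; cbn [lam_var sub_term scons].
  + refine (eqf_trans (eha _ (ax_Sigma _ _ _)) (eha _ (ax_Pi _ _))).
  + exact (eha _ (ax_Pi _ _)).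
- refine (eqf_trans (eha _ (ax_Sigma _ _ _)) _).
  now apply eqf_app.
Qed.

Lemma beta G (H : list (form G)) s t (b : term (s :: G) t) x :
  H ⊢ lam b @ x ≐ sub_term (scons x (fun _ v => Var v)) b.
Proof. rewrite <- (sub_term_id (lam b)); apply beta_sub. Qed.

Lemma beta2 G (H : list (form G)) s r t (b : term (r :: s :: G) t) x y :
  H ⊢ lam (lam b) @ x @ y ≐
      sub_term (scons y (scons x (fun _ v => Var v))) b.
Proof.
exact (eqf_trans (eqf_app_fun y (beta H (lam b) x)) (beta_sub _ _ _ _)).
Qed.

Lemma nat_induction G (H : list (form G)) (A : form (N :: G)) :
  internal A = true -> H ⊢ inst Zero A ->
  A :: map (ren_form wk) H ⊢ inst (Succ @ v0) (wk1 A) ->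
  forall a, H ⊢ inst a A.
Proof.
intros iA A0 AS a; apply prv_allE.
refine (prv_impE (eha _ (internal_induction iA)) (prv_andI A0 _)).
now apply prv_allI, prv_impI.
Qed.

Lemma pred_0 G (H : list (form G)) : H ⊢ predt @ Zero ≐ Zero.
Proof.
refine (eqf_trans (beta _ _ _) _); exact (eha _ (ax_Rec0 (s := N) _ _)).
Qed.

(** Substitution computes on concrete step terms, so the successor laws of [predt], [addt], [monust]
    and [sgt] are instances up to conversion. *)
Lemma rec_S G (H : list (form G)) s n (y : term G s) (b : term (N :: s :: G) s) :
  H ⊢ Rec s @ (Succ @ n) @ y @ lam (lam b) ≐
      sub_term (scons n (scons (Rec s @ n @ y @ lam (lam b))
                               (fun _ v => Var v))) b.
Proof. exact (eqf_trans (eha _ (ax_RecS _ _ _)) (beta2 _ _ _ _)). Qed.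

Lemma pred_S G (H : list (form G)) a : H ⊢ predt @ (Succ @ a) ≐ a.
Proof.
refine (eqf_trans (beta _ _ _) _); exact (rec_S _ _ Zero v0).
Qed.

Lemma add_S G (H : list (form G)) a b :
  H ⊢ addt a (Succ @ b) ≐ Succ @ addt a b.
Proof. exact (rec_S _ _ _ (Succ @ v1)). Qed.

Lemma monus_0 G (H : list (form G)) a : H ⊢ monust a Zero ≐ a.
Proof. exact (eha _ (ax_Rec0 (s := N) _ _)). Qed.

Lemma monus_S G (H : list (form G)) a b :
  H ⊢ monust a (Succ @ b) ≐ predt @ monust a b.
Proof. exact (rec_S _ _ _ (predt @ v1)). Qed.

Lemma monus_cong G (H : list (form G)) a a' b b' :
  H ⊢ a ≐ a' -> H ⊢ b ≐ b' -> H ⊢ monust a b ≐ monust a' b'.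
Proof.
intros Ea Eb; unfold monust.
repeat (apply eqf_app; trivial); apply eqf_refl.
Qed.

(** Induction on [b]: each successor on the right applies [predt] to both sides, and at zero [predt]
    cancels the [Succ] on [a]. *)
Lemma monus_SS G (H : list (form G)) a b :
  H ⊢ monust (Succ @ a) (Succ @ b) ≐ monust a b.
Proof.
pose (A := monust (Succ @ ^a) (Succ @ v0) ≐ monust (^a) v0).
assert (HA : H ⊢ inst b A).
{ apply nat_induction; [reflexivity| |];
  unfold inst, wk1, A; simpl; rewrite ?ren_up_wk, ?sub_scons_wk, ?sub_term_id.
  - apply eqf_trans with (predt @ (Succ @ a)).
    + refine (eqf_trans (monus_S _ _ _) (eqf_app (eqf_refl _ _) _)).
      apply monus_0.
    + refine (eqf_trans (pred_S _ _) (eqf_sym (monus_0 _ _))).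
  - refine (eqf_trans (monus_S _ _ _) (eqf_trans _ (eqf_sym (monus_S _ _ _)))).
    refine (eqf_app (eqf_refl _ _) _); hyp. }
revert HA; unfold inst, A; simpl.
now rewrite sub_scons_wk, sub_term_id.
Qed.

Lemma monus_0l G (H : list (form G)) a : H ⊢ monust Zero a ≐ Zero.
Proof.
apply nat_induction with (A := monust Zero v0 ≐ Zero); [reflexivity| |].
- apply monus_0.
- refine (eqf_trans (monus_S _ _ v0) _).
  refine (eqf_trans (eqf_app (eqf_refl _ _) _) (pred_0 _)); hyp.
Qed.

(** This is b <= a + b. Since [pairt n m] ends by adding [m], it bounds m by the code of (n, m). *)
Lemma monus_add G (H : list (form G)) a b : H ⊢ monust b (addt a b) ≐ Zero.
Proof.
pose (A := monust v0 (addt (^a) v0) ≐ Zero).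
assert (HA : H ⊢ inst b A).
{ apply nat_induction; [reflexivity| |];
  unfold inst, wk1, A; simpl; rewrite ?ren_up_wk, ?sub_scons_wk, ?sub_term_id.
  - refine (eqf_trans (monus_cong (eqf_refl _ _) _) (monus_0l _ a)).
    exact (eha _ (ax_Rec0 (s := N) _ _)).
  - refine (eqf_trans (monus_cong (eqf_refl _ _) (add_S _ _ _)) _).
    refine (eqf_trans (monus_SS _ _ _) _); hyp. }
revert HA; unfold inst, A; simpl.
now rewrite sub_scons_wk, sub_term_id.
Qed.

(** By induction (a + 1) - a = 1, so the hypothesis yields 1 = 0. *)
Lemma succ_nle G (H : list (form G)) a :
  H ⊢ monust (Succ @ a) a ≐ Zero -> H ⊢ Bot.
Proof.
intros E; apply (prv_impE (eha _ (succ_neq0 Zero))).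
refine (eqf_trans (eqf_sym _) E); clear E.
apply nat_induction with (A := monust (Succ @ v0) v0 ≐ one); [reflexivity| |].
- apply monus_0.
- refine (eqf_trans (monus_SS _ _ _) _); hyp.
Qed.

(** The logic is intuitionistic; the zero test is decided by induction, serving as a case split. *)
Lemma eq0_dec G (H : list (form G)) a : H ⊢ (a ≐ Zero ⊔ (a ≐ Zero ⊃ Bot)).
Proof.
apply nat_induction with (A := v0 ≐ Zero ⊔ (v0 ≐ Zero ⊃ Bot)); [reflexivity| |].
- apply prv_orI1; exact (eqf_refl _ Zero).
- apply prv_orI2; exact (eha _ (succ_neq0 _)).
Qed.

Lemma sg_0 G (H : list (form G)) : H ⊢ sgt Zero ≐ Zero.
Proof. exact (eha _ (ax_Rec0 (s := N) _ _)). Qed.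

Lemma sg_S G (H : list (form G)) a : H ⊢ sgt (Succ @ a) ≐ one.
Proof. exact (rec_S _ _ _ one). Qed.

Lemma sg_cong G (H : list (form G)) a b : H ⊢ a ≐ b -> H ⊢ sgt a ≐ sgt b.
Proof.
intros E; unfold sgt; repeat (apply eqf_app; trivial); apply eqf_refl.
Qed.

Lemma sg_le_one G (H : list (form G)) a : H ⊢ monust (sgt a) one ≐ Zero.
Proof.
apply nat_induction with (A := monust (sgt v0) one ≐ Zero); [reflexivity| |].
- refine (eqf_trans (monus_cong (sg_0 _) (eqf_refl _ _)) _).
  refine (eqf_trans (monus_S _ _ _) _).
  exact (eqf_trans (eqf_app (eqf_refl _ _) (monus_0 _ _)) (pred_0 _)).
- refine (eqf_trans (monus_cong (sg_S _ _) (eqf_refl _ _)) _).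
  exact (eqf_trans (monus_SS _ _ _) (monus_0 _ _)).
Qed.

Lemma sg_eq0 G (H : list (form G)) a : H ⊢ (sgt a ≐ Zero ⊃ a ≐ Zero).
Proof.
apply nat_induction with (A := sgt v0 ≐ Zero ⊃ v0 ≐ Zero); [reflexivity| |].
- apply prv_impI; exact (eqf_refl _ Zero).
- apply prv_impI, prv_botE, (prv_impE (eha _ (succ_neq0 Zero))).
  refine (eqf_trans (eqf_sym (sg_S _ v0)) _); hyp.
Qed.

Lemma thr_app G (H : list (form G)) x p : H ⊢ thr @ x @ p ≐ sgt (monust x p).
Proof. exact (beta2 _ (sgt (monust v1 v0)) _ _). Qed.

Lemma const_one G (H : list (form G)) p : H ⊢ lam (s := N) one @ p ≐ one.
Proof. exact (beta (s := N) _ one _). Qed.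

Lemma thr_binary G (H : list (form G)) x : H ⊢ binary (thr @ x).
Proof.
apply prv_allI.
refine (eqf_trans (monus_cong (thr_app _ (^x) v0) (const_one _ v0)) _).
apply sg_le_one.
Qed.

Lemma ren_form_binary G D (r : ren G D) f :
  ren_form r (binary f) = binary (ren_term r f).
Proof. simpl; rewrite ren_up_wk; reflexivity. Qed.

Lemma binary_app G (H : list (form G)) f a :
  H ⊢ binary f -> H ⊢ monust (f @ a) one ≐ Zero.
Proof.
intros B; apply (prv_allE a) in B; revert B.
unfold inst; simpl; rewrite sub_scons_wk, sub_term_id; intros B.
refine (eqf_trans (monus_cong (eqf_refl _ _) (eqf_sym (const_one _ a))) B).
Qed.

(** The bound is constant, so the two conjuncts of majorization reduce to f(u) <= 1 and 1 <= 1. *)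
Lemma binary_maj G (H : list (form G)) f : H ⊢ (binary f ⊃ f ≤* lam one).
Proof.
apply prv_impI, prv_allI, prv_allI, prv_impI.
cbn [map]; rewrite !ren_form_binary.
apply prv_andI.
- refine (eqf_trans (monus_cong (eqf_refl _ _) (const_one _ _)) _).
  apply binary_app; hyp.
- refine (eqf_trans (monus_cong (const_one _ _) (const_one _ _)) _).
  refine (eqf_trans (monus_SS _ _ _) (monus_0 _ _)).
Qed.

End Arithmetic.

(** * Closure of the standard objects, decidability of standardness, and the contradiction *)

Section Nonstandard.

Context (T : theory) (dg : forall G (A : form G), DG A -> T G A)
        (aca : forall G, T G (ren_form (@no_var G) ACA0st)).

Notation "H ⊢ A" := (prv T H A) (at level 75).

Let eha G (A : form G) (E : EHAomega A) : T A := dg (DG_EHA E).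

Lemma st_const G (H : list (form G)) s (a : term [] s) :
  H ⊢ St (ren_term (@no_var G) a).
Proof. apply prv_ax, dg, st_closed. Qed.

Lemma st_appI G (H : list (form G)) s t (f : term G (s ~> t)) x :
  H ⊢ St f -> H ⊢ St x -> H ⊢ St (f @ x).
Proof.
intros Sf; apply prv_impE, (fun h => prv_impE h Sf), prv_ax, dg, st_app.
Qed.

Lemma st_majI G (H : list (form G)) s (x y : term G s) :
  H ⊢ St y -> H ⊢ x ≤* y -> H ⊢ St x.
Proof.
intros Sy; apply prv_impE, (fun h => prv_impE h Sy), prv_ax, dg, st_maj.
Qed.

(** The step is a closed term, hence standard; [addt] and [triangulart] have this shape up to
    conversion. *)
Lemma st_rec G (H : list (form G)) a b c :
  H ⊢ St a -> H ⊢ St b -> H ⊢ St (Rec N @ a @ b @ ren_term (@no_var G) c).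
Proof.
intros Sa Sb; refine (st_appI (st_appI (st_appI _ Sa) Sb) (st_const H c)).
exact (st_const H (Rec N)).
Qed.

Lemma st_add G (H : list (form G)) a b :
  H ⊢ St a -> H ⊢ St b -> H ⊢ St (addt a b).
Proof.
intros Sa Sb; exact (st_rec (lam (lam (Succ @ v1))) Sb Sa).
Qed.

Lemma st_pair G (H : list (form G)) n m :
  H ⊢ St n -> H ⊢ St m -> H ⊢ St (pairt n m).
Proof.
intros Sn Sm; apply st_add, Sm.
exact (st_rec (lam (lam (addt v1 (Succ @ v0)))) (st_add Sn Sm)
         (st_const H Zero)).
Qed.

(* Stated for a variable, so that the substitutions in the instance of
   comprehension compute. *)
Lemma st_dec G (H : list (form (N :: G))) :
  H ⊢ (St (v0 : term (N :: G) N) ⊔ (St (v0 : term (N :: G) N) ⊃ Bot)).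
Proof.
assert (B := thr_binary eha H v0).
assert (S : H ⊢ St (thr @ v0)).
{ refine (st_majI (st_const H (lam one)) _).
  exact (prv_impE (binary_maj eha _ _) B). }
assert (P := prv_ax H (aca _)); apply (prv_allE (thr @ v0)) in P.
apply (fun h => prv_impE h S), (fun h => prv_impE h B) in P.
refine (prv_exE P _); clear P.
match goal with |- prv _ (?A :: ?H') _ =>
  assert (P : A :: H' ⊢ A) by hyp;
  set (H0 := A :: H') in *; clearbody H0 end.
apply prv_andE2, prv_andE2, (prv_allE Zero) in P.
apply (fun h => prv_impE h (st_const H0 Zero)) in P.
(* Here [v0] is m, the next variable is the sequence g given by comprehension, and [VS (VS V0)] is
   the number x under test. *)
pose (A := St v0 ⊓ thr @ Var (VS (VS V0)) @ pairt Zero v0 ≐ Zero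
        : form (N :: N ~> N :: N :: G)).
assert (Dir : H0 ⊢ (Ex N A ⊃ v0 @ Zero ≐ Zero)) by exact (prv_andE1 P).
assert (Inv : H0 ⊢ (v0 @ Zero ≐ Zero ⊃ Ex N A)) by exact (prv_andE2 P).
clear P.
refine (prv_orE (eq0_dec eha H0 (v0 @ Zero)) _ _).
(* If g(0) = 0, some standard m has x <= (0, m), and this standard code majorizes x. *)
- refine (prv_exE (prv_impE (prv_weaken Inv (incl_tl _ (incl_refl _))) _) _);
    [hyp|].
  match goal with |- prv _ ?H1 _ => assert (P : H1 ⊢ A) by hyp end.
  apply prv_orI1.
  refine (st_majI (st_pair (st_const _ Zero) (prv_andE1 P)) _).
  refine (prv_impE (sg_eq0 eha _ _) _).
  exact (eqf_trans eha (eqf_sym eha (thr_app eha _ _ _)) (prv_andE2 P)).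
- apply prv_orI2, prv_impI.
  apply prv_impE with (v0 @ Zero ≐ Zero); [hyp|].
  refine (prv_impE (prv_weaken Dir (incl_tl _ (incl_tl _ (incl_refl _)))) _).
  (* The witness [v1] is x itself: if x were standard, m = x would do, since x <= (0, x). *)
  refine (prv_exI (A := A) (a := v1) (prv_andI _ _)); [hyp|].
  refine (eqf_trans eha (thr_app eha _ v1 (pairt Zero v1)) _).
  exact (eqf_trans eha (sg_cong eha (monus_add eha _ _ _)) (sg_0 eha _)).
Qed.

Lemma aca_inconsistent : ([] : list (form [])) ⊢ Bot.
Proof.
pose (A := St v1 ⊃ v1 ≐ v0 : form [N; N]).
assert (R : ([] : list (form [])) ⊢ All N (ex_st N A)).
{ apply prv_allI, (prv_orE (st_dec _)).
  - refine (prv_exI (A := St v0 ⊓ A) (a := v0) (prv_andI _ (prv_impI _))); [hyp|].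
    exact (eqf_refl eha _ v0).
  (* For nonstandard x any standard value serves as y; 0 is the default. *)
  - refine (prv_exI (A := St v0 ⊓ A) (a := Zero)
              (prv_andI (st_const _ Zero) (prv_impI _))).
    apply prv_botE, prv_impE with (St (v0 : term [N] N)); hyp. }
refine (prv_exE (prv_impE (prv_ax _ (dg (realization A))) R) _).
match goal with |- prv _ (?A :: ?H') _ =>
  assert (P : A :: H' ⊢ A) by hyp;
  set (H0 := A :: H') in *; clearbody H0 end.
assert (Sz := prv_andE1 P).
apply prv_andE2, prv_andE2, (prv_allE (Succ @ v0)) in P.
(* A cut: standardness of z + 1 joins the hypotheses before y is opened, so that it is renamed along
   with them and remains available to the last [hyp]. *)
refine (prv_impE (prv_impI _) (st_appI (st_const _ Succ) Sz)).
refine (prv_exE (prv_weaken P (incl_tl _ (incl_refl _))) _).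
match goal with |- prv _ (?A :: ?H') _ =>
  assert (Q : A :: H' ⊢ A) by hyp end.
(* With [v1] as z and [v0] as y: z + 1 = y and y <= z give z + 1 <= z. *)
refine (succ_nle eha (a := v1) (eqf_trans eha
          (monus_cong eha (prv_impE (prv_andE2 Q) _) (eqf_refl eha _ _))
          (prv_andE1 Q))).
hyp.
Qed.

End Nonstandard.

Theorem theorem3p13 : inconsistent (extend DG ACA0st).
Proof.
apply aca_inconsistent.
- intros G A D; left; exact D.
- intros G; right; reflexivity.
Qed.
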